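(* Let $n\ge1$, let $p>2$ be an integer, let $P(\partial_z)\in\mathbb{C}[\partial_z]$ ($z\in\mathbb{C}^n$) be a homogeneous partial differential operator of order $p$ with constant coefficients, and let $m$ be a function of order $p$. Then the series $$\sum_{j=0}^{\infty}\frac{P^j(\partial_z)\varphi(z)}{m(j)}t^{pj}$$ is not a generalised integral mean for any Borel measure $\mu$ of compact support in $\mathbb{R}^n$; that is, there is no finite complex Borel measure $\mu$ on $\mathbb{R}^n$ with compact support such that $M_\mu(\varphi;z,t)=\sum_{j\ge0}\frac{P^j(\partial_z)\varphi(z)}{m(j)}t^{pj}$ for all $\varphi$ holomorphic in a neighbourhood of the origin in $\mathbb{C}^n$ (and all $(z,t)$ near the origin).
   Context: A function of order $p>0$ is a function $m$ on $\mathbb{N}_0$ for which there exist $c,C>0$ with $c^j\Gamma(1+pj)\le m(j)\le C^j\Gamma(1+pj)$ for all $j\in\mathbb{N}_0$. For a finite complex Borel measure $\mu$ on $\mathbb{R}^n$ with compact support, the generalised integral mean of $\varphi$ is $M_\mu(\varphi;z,t)=\int_{\mathbb{R}^n}\varphi(z+ty)\,d\mu(y)$, $z\in\mathbb{C}^n$, $t\in\mathbb{C}$. *)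

(* Defs.v *)
From HB Require Import structures.
From mathcomp Require Import all_boot all_order all_algebra.
From mathcomp Require Import all_classical all_reals all_analysis.
From mathcomp Require Export complex.
Export Order.TTheory GRing.Theory Num.Theory.
Export numFieldNormedType.Exports.

Set Implicit Arguments.
Unset Strict Implicit.
Unset Printing Implicit Defensive.

Local Open Scope ring_scope.
Local Open Scope classical_set_scope.

Definition Cx (R : realType) : numFieldType := (R[i] : numFieldType).

Definition RtoC (R : realType) (x : R) : Cx R := Complex x 0.

Definition embC (R : realType) (n : nat) (y : 'rV[R]_n) : 'rV[Cx R]_n :=
  map_mx (@RtoC R) y.

Definition BorelRn (R : realType) (n : nat) := g_sigma_algebraType (@open 'rV[R]_n).

Definition cint_pos (R : realType) (n : nat)
  (nu : {finite_measure set (BorelRn R n) -> \bar R})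
  (K : set (BorelRn R n)) (f : 'rV[R]_n -> Cx R) : Cx R :=
  Complex (Rintegral nu K (fun y => complex.Re (f y)))
          (Rintegral nu K (fun y => complex.Im (f y))).

(* A finite complex Borel measure mu on R^n is represented by its
   (Jordan-type) decomposition mu = nu1 - nu2 + i (nu3 - nu4) into finite
   positive Borel measures.  Integral over K of f w.r.t. mu: *)
Definition cint (R : realType) (n : nat)
  (nu1 nu2 nu3 nu4 : {finite_measure set (BorelRn R n) -> \bar R})
  (K : set (BorelRn R n)) (f : 'rV[R]_n -> Cx R) : Cx R :=
  (cint_pos nu1 K f - cint_pos nu2 K f)
  + Complex 0 1 * (cint_pos nu3 K f - cint_pos nu4 K f).

Definition gen_mean (R : realType) (n : nat)
  (nu1 nu2 nu3 nu4 : {finite_measure set (BorelRn R n) -> \bar R})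
  (K : set (BorelRn R n)) (phi : 'rV[Cx R]_n -> (Cx R)^o)
  (z : 'rV[Cx R]_n) (t : Cx R) : Cx R :=
  cint nu1 nu2 nu3 nu4 K (fun y => phi (z + t *: embC y)).

Definition holo_near0 (R : realType) (n : nat) (phi : 'rV[Cx R]_n -> (Cx R)^o) : Prop :=
  exists U : set 'rV[Cx R]_n, open U /\ U 0 /\ forall z, U z -> differentiable phi z.

Definition pd (R : realType) (n : nat) (i : 'I_n) (phi : 'rV[Cx R]_n -> (Cx R)^o)
  : 'rV[Cx R]_n -> (Cx R)^o :=
  fun z => 'D_(delta_mx 0 i) phi z.

Definition applyP (R : realType) (n p : nat) (b : p.-tuple 'I_n -> Cx R)
  (phi : 'rV[Cx R]_n -> (Cx R)^o) : 'rV[Cx R]_n -> (Cx R)^o :=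
  fun z => \sum_(s : p.-tuple 'I_n) b s * foldr (@pd R n) phi s z.

Definition iterP (R : realType) (n p : nat) (b : p.-tuple 'I_n -> Cx R) (j : nat)
  (phi : 'rV[Cx R]_n -> (Cx R)^o) : 'rV[Cx R]_n -> (Cx R)^o :=
  iter j (applyP b) phi.

Definition symbolP (R : realType) (n p : nat) (b : p.-tuple 'I_n -> Cx R)
  (xi : 'rV[Cx R]_n) : Cx R :=
  \sum_(s : p.-tuple 'I_n) b s * \prod_(i <- s) xi 0 i.

Definition order_exactly (R : realType) (n p : nat) (b : p.-tuple 'I_n -> Cx R) : Prop :=
  exists xi : 'rV[Cx R]_n, symbolP b xi != 0.

(* m is a function of order p: c^j Gamma(1+pj) <= m(j) <= C^j Gamma(1+pj);
   for integer arguments Gamma(1 + pj) = (pj)!. *)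
Definition fun_of_order (R : realType) (p : nat) (m : nat -> R) : Prop :=
  exists c C : R, 0 < c /\ 0 < C /\
    forall j : nat, c ^+ j * ((p * j)`!)%:R <= m j /\ m j <= C ^+ j * ((p * j)`!)%:R.

(* Main.v *)
Require Import Defs.
From HB Require Import structures.
From mathcomp Require Import all_boot all_order all_algebra.
From mathcomp Require Import all_classical all_reals all_analysis.
From mathcomp Require Import complex measurable_realfun.
From mathcomp Require Import ring.
Import Order.TTheory GRing.Theory Num.Theory.
Import numFieldNormedType.Exports.
Local Open Scope ring_scope.
Local Open Scope classical_set_scope.

(** Testing the identity on [phi w = (eta . w) ^ k] at [z = 0], with [eta] real,
    shows that the moments [\int (eta . y) ^ k dmu] vanish unless [p %| k],
    while for [k = 2 p] the moment is a nonzero multiple of [P(eta) ^ 2]; and a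
    real [eta] with [P(eta) != 0] exists because a nonzero polynomial cannot
    vanish at all real points.  Rescale so that [|x| <= 1] for [x = eta . y] on
    the support.  Since [p > 2], no exponent [2 + 2 p i] is divisible by [p], so
    every function [x ^ 2 * q (x ^ (2 p))] with [q] a polynomial integrates to
    [0]; but [x ^ (2 p)] is a bounded pointwise limit of such functions, because
    [x ^ 2 = (x ^ (2 p)) ^ (1 / p)] is a limit of polynomials in [x ^ (2 p)].
    Hence the [2 p]-th moment vanishes too, a contradiction. *)

(** * Action of [P] and its iterates on powers of a linear form *)

Lemma ffactnD (n m k : nat) : (n ^_ (m + k) = n ^_ m * (n - m) ^_ k)%N.
Proof.
elim: k => [|k IH]; first by rewrite addn0 ffactn0 muln1.
by rewrite addnS !ffactnSr IH mulnA subnDA.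
Qed.

Definition linform {K : numFieldType} {n : nat} (xi z : 'rV[K]_n) : K^o :=
  \sum_(i < n) xi 0 i * z 0 i.

Lemma differentiable_linform {K : numFieldType} {n : nat} (xi z : 'rV[K]_n) :
  differentiable (linform xi) z.
Proof.
rewrite (_ : linform xi =
  \sum_(i < n) (xi 0 i \*: (fun z : 'rV[K]_n => z 0 i : K^o))); last first.
  by apply/funext => w; rewrite fct_sumE.
apply: differentiable_sum => i; apply: differentiableZ.
exact: differentiable_coord.
Qed.

Lemma differentiable_linformX {K : numFieldType} {n : nat} (xi z : 'rV[K]_n) (k : nat) :
  differentiable (fun w => linform xi w ^+ k : K^o) z.
Proof.
rewrite (_ : (fun w => _) = linform xi ^+ k); last first.
  by apply/funext => w; rewrite exprfctE.
case: k => [|k]; first by rewrite expr0; exact: differentiable_cst.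
exact/differentiableX/differentiable_linform.
Qed.

Lemma linformZl {K : numFieldType} {n : nat} (a : K) (xi z : 'rV[K]_n) :
  linform (a *: xi) z = a * linform xi z.
Proof. by rewrite /linform mulr_sumr; apply: eq_bigr => i _; rewrite mxE mulrA. Qed.

Lemma is_derive_linform {K : numFieldType} {n : nat} (xi z v : 'rV[K]_n) :
  is_derive z v (linform xi) (linform xi v).
Proof.
have quotE : (fun h : K => h^-1 *: ((linform xi \o shift z) (h *: v) - linform xi z))
    @ 0^' --> linform xi v.
  apply: cvg_near_cst; near=> h.
  have h0 : h != 0 by near: h; exact: nbhs_dnbhs_neq.
  rewrite /= /linform -sumrB scaler_sumr; apply: eq_bigr => i _.
  by rewrite !mxE mulrDr addrK mulrCA /GRing.scale /= mulKf.
have dl : derivable (linform xi) z v by apply/cvg_ex; exists (linform xi v); exact: quotE.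
by apply: (DeriveDef dl); apply: cvg_lim.
Unshelve. all: by end_near. Qed.

(** The scalar [a] is carried along so that the result again has the form of the input and the rule
    can be iterated. At [k = 0] the truncated exponent [k.-1] is harmless, because the factor [k%:R]
    vanishes. *)
Lemma pd_linformX {R : realType} {n : nat} (i : 'I_n) (xi : 'rV[Cx R]_n)
    (a : Cx R) (k : nat) :
  pd i (fun z => a * linform xi z ^+ k) =
  (fun z => a * k%:R * xi 0 i * linform xi z ^+ k.-1).
Proof.
apply/funext => z; rewrite /pd.
have Dl := is_derive_linform xi z (delta_mx 0 i).
have := @is_deriveZ _ _ _ _ a _ _ _ (@is_deriveX _ _ _ k _ _ _ Dl).
move=> /(@derive_val _ _ _ _ _ _ _).
rewrite (_ : a \*: (linform xi) ^+ k = (fun z => a * linform xi z ^+ k)); last first.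
  by apply/funext => w; rewrite /= exprfctE.
move=> ->.
have -> : linform xi (delta_mx 0 i) = xi 0 i.
  rewrite /linform (bigD1 i)//= mxE !eqxx mulr1 big1 ?addr0// => j jNi.
  by rewrite mxE (negbTE jNi) mulr0.
rewrite /GRing.scale /=; ring.
Qed.

Lemma applyP_linformX {R : realType} {n p : nat} (b : p.-tuple 'I_n -> Cx R)
    (xi : 'rV[Cx R]_n) (a : Cx R) (k : nat) :
  applyP b (fun z => a * linform xi z ^+ k) =
  (fun z => a * symbolP b xi * (k ^_ p)%:R * linform xi z ^+ (k - p)).
Proof.
have foldE (s : seq 'I_n) : foldr (@pd R n) (fun z => a * linform xi z ^+ k) s =
    (fun z => a * (k ^_ (size s))%:R * \prod_(i <- s) xi 0 i
              * linform xi z ^+ (k - size s)).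
  elim: s => [|i s IH] /=.
    by apply/funext => z; rewrite big_nil ffactn0 subn0 !mulr1.
  rewrite IH pd_linformX; apply/funext => z.
  rewrite subnS; congr (_ * _).
  by rewrite big_cons ffactnSr natrM; ring.
apply/funext => z; rewrite /applyP /symbolP.
under eq_bigr do rewrite foldE size_tuple.
rewrite mulr_sumr !mulr_suml; apply: eq_bigr => s _. ring.
Qed.

Lemma iterP_linformX {R : realType} {n p : nat} (b : p.-tuple 'I_n -> Cx R)
    (xi : 'rV[Cx R]_n) (k j : nat) :
  iterP b j (fun z => linform xi z ^+ k) =
  (fun z => symbolP b xi ^+ j * (k ^_ (p * j))%:R * linform xi z ^+ (k - p * j)).
Proof.
elim: j => [|j IH].
  by apply/funext => z; rewrite /= muln0 ffactn0 subn0 !mul1r.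
rewrite /iterP iterS -/(iterP _ _ _) IH applyP_linformX; apply/funext => z.
(* [ffactnD] merges the falling factorial of the first [p * j] derivatives with that of the next
   [p]. *)
rewrite exprS mulnS addnC -subnDA; congr (_ * _).
by rewrite ffactnD natrM; ring.
Qed.

(** * Polynomial approximation of the [p]-th root on the unit interval *)

(* Iteration converging to [u] when evaluated at [u ^+ p], for [0 <= u <= 1]. *)
Fixpoint root_approx (K : fieldType) (p k : nat) : {poly K} :=
  if k is k'.+1 then
    root_approx K p k' + (p%:R^-1)%:P * ('X - root_approx K p k' ^+ p)
  else 0.

(** Factoring [u ^+ p - q ^+ p] as [(u - q) * S] shows that one step multiplies the error [u - q] by
    [1 - S / p]. Since [0 <= q <= u <= 1], the sum [S] lies between its first term [u ^+ p.-1] and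
    [p], so the error keeps its sign and shrinks at least geometrically. *)
Lemma root_approx_bound {R : realFieldType} (p k : nat) (u : R) :
  (0 < p)%N -> 0 <= u <= 1 ->
  0 <= (root_approx R p k).[u ^+ p] /\
  0 <= u - (root_approx R p k).[u ^+ p] <= u * (1 - u ^+ p.-1 / p%:R) ^+ k.
Proof.
move=> p0 /andP[u0 u1]; elim: k => [|k [] + /andP[]].
  by rewrite /= horner0 subr0 expr0 mulr1 lexx u0.
rewrite /= hornerD hornerM hornerC hornerD hornerX hornerN horner_exp.
set q := (root_approx R p k).[_] => q0 qu qb.
have pp : 0 < p%:R :> R by rewrite ltr0n.
rewrite subrXX.
set S := \sum_(i < p) _.
have qleu : q <= u by rewrite -subr_ge0.
have S_le : S <= p%:R.
  rewrite -[leRHS](_ : \sum_(i < p) 1 = _); last by rewrite sumr_const card_ord.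
  apply: ler_sum => i _; rewrite mulr_ile1 ?exprn_ge0 ?exprn_ile1//.
  exact: le_trans u1.
have S_ge : u ^+ p.-1 <= S.
  rewrite /S; case: (p) p0 => // p' _.
  rewrite big_ord_recl /= subn0 expr0 mulr1 lerDl.
  by apply: sumr_ge0 => i _; rewrite mulr_ge0// exprn_ge0.
have S0 : 0 <= S by apply: le_trans S_ge; rewrite exprn_ge0.
have SpE : u - (q + p%:R^-1 * ((u - q) * S)) = (u - q) * (1 - S / p%:R) by ring.
have Sp1 : S / p%:R <= 1 by rewrite ler_pdivrMr// mul1r.
split; first by rewrite addr_ge0// mulr_ge0 ?invr_ge0 ?mulr_ge0// ltW.
rewrite SpE mulr_ge0//= ?subr_ge0//.
rewrite exprSr mulrA ler_pM ?subr_ge0//.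
by rewrite lerD2l lerN2 ler_pM2r ?invr_gt0.
Qed.

Lemma cvg_root_approx {R : realType} (p : nat) (u : R) :
  (0 < p)%N -> 0 <= u <= 1 ->
  (fun k => (root_approx R p k).[u ^+ p]) @ \oo --> u.
Proof.
move=> p0 u01.
suff h : (fun k => u - (root_approx R p k).[u ^+ p]) @ \oo --> (0 : R).
  rewrite -[X in _ --> X]subr0.
  rewrite (_ : (fun k => _) = (fun k => u - (u - (root_approx R p k).[u ^+ p]))).
    by apply: cvgB => //; exact: cvg_cst.
  by apply/funext => k; rewrite subKr.
apply: (@squeeze_cvgr _ _ _ _ (cst 0) (fun k => u * (1 - u ^+ p.-1 / p%:R) ^+ k)).
- by apply: nearW => k; have [_] := root_approx_bound p k u p0 u01.
- exact: cvg_cst.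
have /andP[u0 u1] := u01.
(* At [u = 0] the ratio of the geometric bound can be [1]; there the prefactor [u] makes the bound
   vanish. *)
have [->|uN0] := eqVneq u 0.
  by under eq_fun do rewrite mul0r; exact: cvg_cst.
have pp : 0 < p%:R :> R by rewrite ltr0n.
rewrite -[X in _ --> X](mulr0 u); apply: cvgM; first exact: cvg_cst.
apply: cvg_expr.
have up : 0 < u ^+ p.-1 by rewrite exprn_gt0// lt_neqAle eq_sym uN0.
have : u ^+ p.-1 / p%:R <= 1.
  by rewrite ler_pdivrMr// mul1r (@le_trans _ _ 1)// ?exprn_ile1// ler1n.
by move=> h; rewrite ger0_norm ?subr_ge0// ltrBlDr ltrDl divr_gt0.
Qed.

(** * Moments of a bounded real function *)

Lemma bounded_integrable {d : measure_display} {T : measurableType d} {R : realType}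
  (nu : {finite_measure set T -> \bar R}) (K : set T) (f : T -> R) (M : R) :
  measurable K -> measurable_fun K f -> (forall x, K x -> `|f x| <= M) ->
  nu.-integrable K (EFin \o f).
Proof.
move=> mK mf fM; apply: measurable_bounded_integrable => //.
  rewrite ltey_eq fin_num_measure//.
exists M; split; first exact: num_real.
move=> x Mx y /= /fM /le_trans; apply; exact: ltW.
Qed.

Lemma Rintegral_poly {d : measure_display} {T : measurableType d} {R : realType}
  (nu : {finite_measure set T -> \bar R}) (K : set T) (f : T -> R)
  (q : {poly R}) (a b : nat) :
  measurable K -> measurable_fun K f -> (forall x, K x -> `|f x| <= 1) ->
  Rintegral nu K (fun x => f x ^+ a * q.[f x ^+ b]) =
  \sum_(i < size q) q`_i * Rintegral nu K (fun x => f x ^+ (a + b * i)).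
Proof.
move=> mK mf f1.
have iX k : nu.-integrable K (EFin \o (fun x => f x ^+ k)).
  apply: (bounded_integrable _ _ _ 1) => //; first exact: measurable_funX.
  by move=> x Kx; rewrite normrX exprn_ile1 ?f1.
have iZ (i : 'I_(size q)) : nu.-integrable K (fun x => (q`_i * f x ^+ (a + b * i))%:E).
  apply: (bounded_integrable _ _ _ `|q`_i|) => //.
    by apply: measurable_funM => //; exact: measurable_funX.
  by move=> x Kx; rewrite normrM normrX ler_piMr// exprn_ile1 ?f1.
rewrite (_ : (fun x => _) = (fun x => \sum_(i < size q) (q`_i * f x ^+ (a + b * i)))).
  rewrite /Rintegral.
  under eq_integral do rewrite -sumEFin.
  rewrite integral_sum//= -sum_fine; last by move=> i _; exact: integrable_fin_num.
  by apply: eq_bigr => i _; rewrite -/(Rintegral _ _ _) RintegralZl.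
apply/funext => x; rewrite horner_coef mulr_sumr; apply: eq_bigr => i _.
by rewrite mulrCA -exprM -exprD.
Qed.

(** Stated for two positive measures, so that it applies separately to the real part [nu1 - nu2] and
    the imaginary part [nu3 - nu4] of the complex measure. *)
Lemma Rintegral_even_power_eq {d : measure_display} {T : measurableType d} {R : realType}
  (nu1 nu2 : {finite_measure set T -> \bar R}) (K : set T) (f : T -> R) (p : nat) :
  (2 < p)%N -> measurable K -> measurable_fun K f -> (forall x, K x -> `|f x| <= 1) ->
  (forall k, ~~ (p %| k)%N ->
    Rintegral nu1 K (fun x => f x ^+ k) = Rintegral nu2 K (fun x => f x ^+ k)) ->
  Rintegral nu1 K (fun x => f x ^+ (2 * p)) = Rintegral nu2 K (fun x => f x ^+ (2 * p)).
Proof.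
move=> p2 mK mf f1 eq12.
have p0 : (0 < p)%N by apply: leq_trans p2.
(* With [u = f x ^+ 2], the approximant at [u ^+ p] tends to [u], so [g k x] tends to
   [u * u ^+ p.-1 = f x ^+ (2 * p)]. *)
pose g k x := f x ^+ 2 * (root_approx R p k ^+ p.-1).[f x ^+ (2 * p)].
have gE k : Rintegral nu1 K (g k) = Rintegral nu2 K (g k).
  rewrite /g !Rintegral_poly//; apply: eq_bigr => i _; congr (_ * _).
  (* The exponents that occur are [2 + 2 * p * i]; divisibility by [p] would force [p] to divide
     [2]. *)
  apply: eq12; rewrite -mulnA [(2 * _)%N]mulnC -mulnA addnC dvdn_addr ?dvdn_mulr//.
  by rewrite gtnNdvd.
have u01 x : K x -> 0 <= f x ^+ 2 <= 1.
  by move=> Kx; rewrite sqr_ge0 /= -(ger0_norm (sqr_ge0 (f x))) normrX exprn_ile1 ?f1.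
have cvg_g (nu : {finite_measure set T -> \bar R}) :
    (fun k => Rintegral nu K (g k)) @ \oo --> Rintegral nu K (fun x => f x ^+ (2 * p)).
  have mg k : measurable_fun K (g k).
    apply: measurable_funM; first exact: measurable_funX.
    apply: (measurableT_comp (f := horner (root_approx R p k ^+ p.-1))
      (g := fun x => f x ^+ (2 * p))); last exact: measurable_funX.
    exact: measurable_poly.
  have [] := @dominated_convergence _ T R nu K mK (fun k => EFin \o g k)
     (EFin \o (fun x => f x ^+ (2 * p))) (cst 1%E).
  - by move=> k; apply/measurable_EFinP.
  - by apply/measurable_EFinP; exact: measurable_funX.
  - apply: aeW => x Kx.
    apply: cvg_EFin; first exact: nearW.
    have cq := cvg_root_approx p (f x ^+ 2) p0 (u01 x Kx).
    rewrite (_ : fine \o _ = (fun k =>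
        f x ^+ 2 * (root_approx R p k).[f x ^+ 2 ^+ p] ^+ p.-1)).
      rewrite (_ : f x ^+ (2 * p) = f x ^+ 2 * (f x ^+ 2) ^+ p.-1); last first.
        by rewrite -exprS prednK// exprM.
      apply: cvgM; first exact: cvg_cst.
      exact: (cvg_comp _ _ cq (@exprn_continuous R p.-1 (f x ^+ 2))).
    by apply/funext => k; rewrite /= /g horner_exp exprM.
  - exact: finite_measure_integrable_cst.
  (* The approximants stay between [0] and [u <= 1], so the constant [1] dominates every [g k]. *)
  - apply: aeW => x k Kx.
    have [q0 /andP[qu _]] := root_approx_bound p k _ p0 (u01 x Kx).
    have /andP[u0 u1] := u01 x Kx.
    rewrite lee_fin /g horner_exp exprM normrM normrX.
    rewrite mulr_ile1 ?exprn_ge0 ?exprn_ile1 ?f1// normrX exprn_ile1//.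
    by rewrite ger0_norm// (le_trans _ u1)// -subr_ge0.
  move=> _ _ h.
  apply: fine_cvg.
  rewrite fineK; first exact: h.
  apply: integrable_fin_num => //.
  apply: (bounded_integrable _ _ _ 1) => //; first exact: measurable_funX.
  by move=> x Kx; rewrite normrX exprn_ile1 ?f1.
apply: (@cvg_unique _ _ _ _ _ _ (cvg_g nu1)) => //.
rewrite (_ : (fun k => _) = (fun k => Rintegral nu2 K (g k))); first exact: cvg_g.
exact/funext.
Qed.

(** * A real vector at which the symbol is nonzero *)

HB.instance Definition _ (R : realType) :=
  GRing.RMorphism.copy (@RtoC R) (real_complex R).

(** Along the complex line [re + x *: im] the symbol is a polynomial [q] in [x]. Natural [x] give
    real vectors, so if the symbol vanished on all of these, [q] would have too many roots and be
    zero; yet its value at the imaginary unit is the symbol at [xi]. *)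
Lemma exists_real_symbolP_neq0 {R : realType} {n p : nat} (b : p.-tuple 'I_n -> Cx R) :
  order_exactly b -> exists eta : 'rV[R]_n, symbolP b (embC eta) != 0.
Proof.
move=> [xi P0]; apply: contrapT => noeta.
pose re : 'rV[R]_n := map_mx (@complex.Re R) xi.
pose im : 'rV[R]_n := map_mx (@complex.Im R) xi.
pose q : {poly Cx R} := \sum_(s : p.-tuple 'I_n)
  b s *: \prod_(i <- s) ((RtoC (re 0 i))%:P + (RtoC (im 0 i))%:P * 'X).
have qE (x : Cx R) : q.[x] = symbolP b (embC re + x *: embC im).
  rewrite /q /symbolP horner_sum; apply: eq_bigr => s _.
  rewrite hornerZ horner_prod; congr (_ * _); apply: eq_bigr => i _.
  by rewrite hornerD hornerM !hornerC hornerX !mxE mulrC.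
have q0 : q = 0.
  apply: (@roots_geq_poly_eq0 _ q [seq (k%:R : Cx R) | k <- iota 0 (size q)]).
  - apply/allP => _ /mapP[k _ ->]; apply/eqP; rewrite qE.
    apply: contrapT => /eqP nz; apply: noeta; exists (re + k%:R *: im).
    rewrite (_ : embC _ = embC re + k%:R *: embC im)//.
    apply/rowP => i; rewrite !mxE.
    by rewrite rmorphD rmorphM/= rmorph_nat.
  - by rewrite map_inj_uniq ?iota_uniq// => ? ? /eqP; rewrite eqr_nat => /eqP.
  - by rewrite size_map size_iota.
move/eqP: P0; apply.
rewrite -(horner0 (Complex 0 1)) -q0 qE; congr symbolP.
apply/rowP => i; rewrite !mxE; case: (xi 0 i) => u v /=.
by rewrite /RtoC; simpc.
Qed.

(** * Measurability, and both sides of the mean identity on powers of a real linear form *)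

Lemma continuous_borel_measurable {R : realType} {n : nat}
    (D : set (BorelRn R n)) (f : 'rV[R]_n -> R) :
  continuous f -> measurable D -> measurable_fun D (f : BorelRn R n -> R).
Proof.
move=> /continuousP cf mD; apply: measurable_funTS.
apply: (measurability _ (RGenOpens.measurableE R)).
move=> _ [_ [a [b ->] <-]]; rewrite setTI; apply: sub_sigma_algebra.
exact/cf/interval_open.
Qed.

Lemma compact_borel_measurable {R : realType} {n : nat} (K : set 'rV[R]_n) :
  compact K -> measurable (K : set (BorelRn R n)).
Proof.
move=> cK; rewrite -[K]setCK; apply: measurableC; apply: sub_sigma_algebra.
apply: closed_openC; apply: compact_closed => //; exact: norm_hausdorff.
Qed.

Lemma normr_RtoC {R : realType} (x : R) : `|RtoC x| = RtoC `|x| :> Cx R.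
Proof. by rewrite normc_def /= expr0n /= addr0 sqrtr_sqr. Qed.

Lemma ltr_RtoC {R : realType} (x y : R) : (RtoC x < RtoC y :> Cx R) = (x < y).
Proof. exact: ltcR. Qed.

Lemma linform_embC {R : realType} {n : nat} (eta y : 'rV[R]_n) (tau : R) :
  linform (embC eta) (0 + RtoC tau *: embC y) = RtoC (tau * linform eta y).
Proof.
rewrite add0r /linform mulr_sumr rmorph_sum; apply: eq_bigr => i _.
by rewrite !mxE !rmorphM/= mulrCA.
Qed.

(** For real [eta] and [tau] the integrand is real, so the four positive measures separate into real
    and imaginary parts. *)
Lemma gen_mean_linformX {R : realType} {n : nat}
    (nu1 nu2 nu3 nu4 : {finite_measure set (BorelRn R n) -> \bar R})
    (K : set (BorelRn R n)) (eta : 'rV[R]_n) (k : nat) (tau : R) :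
  let I (nu : {finite_measure set (BorelRn R n) -> \bar R}) :=
    Rintegral nu K (fun y => (tau * linform eta y) ^+ k) in
  gen_mean nu1 nu2 nu3 nu4 K (fun z => linform (embC eta) z ^+ k) 0 (RtoC tau) =
  Complex (I nu1 - I nu2) (I nu3 - I nu4).
Proof.
move=> I; rewrite /gen_mean.
have -> : (fun y => linform (embC eta) (0 + RtoC tau *: embC y) ^+ k) =
    (fun y => RtoC ((tau * linform eta y) ^+ k)).
  by apply/funext => y; rewrite linform_embC rmorphXn.
have cE (nu : {finite_measure set (BorelRn R n) -> \bar R}) :
    cint_pos nu K (fun y => RtoC ((tau * linform eta y) ^+ k)) = RtoC (I nu).
  rewrite /cint_pos /RtoC /=; congr Complex.
  by rewrite /Rintegral; under eq_integral do rewrite /=; rewrite integral0.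
rewrite /cint !cE -!rmorphB /RtoC /=.
by rewrite /GRing.mul /GRing.add /=; congr Complex; ring.
Qed.

(** At the origin only the term with [p * j = k] survives, so the partial sums are eventually
    constant. *)
Lemma cvg_series_iterP_linformX {R : realType} {n p : nat} (b : p.-tuple 'I_n -> Cx R)
    (m : nat -> R) (xi : 'rV[Cx R]_n) (k : nat) (t : Cx R) :
  (0 < p)%N ->
  series (fun j => iterP b j (fun z => linform xi z ^+ k) 0 / RtoC (m j) * t ^+ (p * j))
    @ \oo --> (if (p %| k)%N then
      symbolP b xi ^+ (k %/ p) * (k`!)%:R / RtoC (m (k %/ p)%N) * t ^+ k else 0 : Cx R).
Proof.
move=> p0; set u := (fun j => _); set l := (if _ then _ else _).
have u0 j : (p * j != k)%N -> u j = 0.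
  move=> jk; rewrite /u iterP_linformX.
  have -> : linform xi 0 = 0 by rewrite /linform big1// => i _; rewrite mxE mulr0.
  case: (ltngtP (p * j) k) jk => // h _.
    by rewrite expr0n subn_eq0 leqNgt h /= mulr0 !mul0r.
  (* When [k < p * j] the truncated exponent is [0] and the power equals [1]; the falling factorial
     is what vanishes. *)
  by rewrite ffact_small// mulr0 !mul0r.
apply: cvg_near_cst; exists k.+1 => // N /= kN.
rewrite /series /= /l; case: ifPn => [/dvdnP[j kE]|pk].
  subst k; rewrite mulnK// [(j * p)%N]mulnC in u kN u0 *.
  have jN : (j < N)%N by apply: leq_ltn_trans kN; rewrite leq_pmull.
  rewrite big_mkord (bigD1 (Ordinal jN))//= big1 ?addr0 => [|i ij].
    by rewrite /u iterP_linformX subnn expr0 mulr1 ffactnn.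
  by rewrite u0// eqn_pmul2l.
rewrite big1// => j _; rewrite u0//.
by apply: contra pk => /eqP <-; exact: dvdn_mulr.
Qed.

(** * Contradiction at the moment of order [2 * p] *)

Theorem theorem3 (R : realType) (n p : nat) (b : p.-tuple 'I_n -> Cx R)
  (m : nat -> R) :
  (1 <= n)%N -> (2 < p)%N -> order_exactly b -> fun_of_order p m ->
  ~ exists (nu1 nu2 nu3 nu4 : {finite_measure set (BorelRn R n) -> \bar R})
           (K : set 'rV[R]_n),
      compact K /\
      (nu1 (~` K) = 0%E /\ nu2 (~` K) = 0%E /\ nu3 (~` K) = 0%E /\ nu4 (~` K) = 0%E) /\
      forall phi : 'rV[Cx R]_n -> (Cx R)^o, holo_near0 phi ->
        exists e : R, 0 < e /\
          forall (z : 'rV[Cx R]_n) (t : Cx R), `|z| < RtoC e -> `|t| < RtoC e ->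
            series (fun j => iterP b j phi z / RtoC (m j) * t ^+ (p * j)) @ \oo
              --> gen_mean nu1 nu2 nu3 nu4 K phi z t.
Proof.
move=> _ p2 /exists_real_symbolP_neq0[eta P0] [c [C [c0 [_ mbd]]]].
move=> [nu1 [nu2 [nu3 [nu4 [K [cK [_ mean]]]]]]].
have p0 : (0 < p)%N by apply: leq_trans p2.
have mK : measurable (K : set (BorelRn R n)) by exact: compact_borel_measurable.
have clin : continuous (linform eta : 'rV[R]_n -> R).
  by move=> y; exact: differentiable_continuous (differentiable_linform eta y).
have [B [B0 fB]] : exists B : R, 0 < B /\ forall y, K y -> `|linform eta y| <= B.
  have /compact_bounded[M [_ Mb]] : compact ((linform eta : 'rV[R]_n -> R^o) @` K).
    by apply: continuous_compact => //; exact: continuous_subspaceT.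
  exists (`|M| + 1); split; first by rewrite ltr_wpDl.
  move=> y Ky; apply: Mb; last by exists y.
  by rewrite ltr_pwDr// ler_norm.
pose f (y : BorelRn R n) : R := linform (B^-1 *: eta) y.
have f1 y : K y -> `|f y| <= 1.
  move=> Ky; rewrite /f linformZl normrM gtr0_norm ?invr_gt0// mulrC ler_pdivrMr// mul1r.
  exact: fB.
have mf : measurable_fun (K : set (BorelRn R n)) f.
  apply: continuous_borel_measurable => //.
  by move=> y; exact: differentiable_continuous (differentiable_linform _ y).
pose I (nu : {finite_measure set (BorelRn R n) -> \bar R}) k : R :=
  Rintegral nu K (fun y => f y ^+ k).
(* The identity is tested at [z = 0] and [t = e / 2]. The radius [e] depends on the test function,
   hence [tau] on [k]; taking [tau = e / 2 * B] absorbs the rescaling of [eta], so that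
   [t = tau / B]. *)
have moment k : exists2 tau : R, 0 < tau &
    Complex (tau ^+ k * (I nu1 k - I nu2 k)) (tau ^+ k * (I nu3 k - I nu4 k)) =
    if (p %| k)%N then symbolP b (embC eta) ^+ (k %/ p) * (k`!)%:R
                        / RtoC (m (k %/ p)%N) * RtoC (tau / B) ^+ k else 0.
  pose phi : 'rV[Cx R]_n -> (Cx R)^o := fun z => linform (embC eta) z ^+ k.
  have hphi : holo_near0 phi.
    exists setT; split; first exact: openT.
    by split=> // z _; exact: differentiable_linformX.
  have [e [e0 cv]] := mean _ hphi.
  have {cv} := cv 0 (RtoC (e / 2)).
  have -> : `|0 : 'rV[Cx R]_n| < RtoC e by rewrite normr0 -(rmorph0 (@RtoC R)) ltr_RtoC.
  have -> : `|RtoC (e / 2)| < RtoC e.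
    rewrite normr_RtoC ltr_RtoC gtr0_norm ?divr_gt0//.
    by rewrite ltr_pdivrMr// ltr_pMr// ltr1n.
  move=> /(_ isT isT) cv.
  exists (e / 2 * B); first by rewrite mulr_gt0// divr_gt0.
  rewrite mulfK ?gt_eqF//.
  have := cvg_unique _ cv (cvg_series_iterP_linformX b m (embC eta) k _ p0).
  move=> /(_ (@norm_hausdorff _ _)) <-.
  rewrite /phi gen_mean_linformX.
  have IE (nu : {finite_measure set (BorelRn R n) -> \bar R}) :
      Rintegral nu K (fun y => (e / 2 * linform eta y) ^+ k) =
      (e / 2 * B) ^+ k * I nu k.
    rewrite /I -RintegralZl//; last first.
      apply: (bounded_integrable _ _ _ 1) => //; first exact: measurable_funX.
      by move=> x Kx; rewrite normrX exprn_ile1 ?f1.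
    apply: eq_Rintegral => y _; rewrite -exprMn /f linformZl; congr (_ ^+ _).
    by field; rewrite gt_eqF.
  by rewrite !IE !mulrBr.
have I0 k : ~~ (p %| k)%N -> I nu1 k = I nu2 k /\ I nu3 k = I nu4 k.
  move=> pk; have [tau tau0] := moment k.
  rewrite (negbTE pk) => -[/eqP + /eqP].
  have tk : tau ^+ k != 0 by rewrite expf_neq0 ?gt_eqF.
  by rewrite !mulf_eq0 !(negbTE tk) !subr_eq0 => /eqP -> /eqP ->.
have [tau tau0] := moment (2 * p)%N.
rewrite dvdn_mull// mulnK//.
rewrite /I (Rintegral_even_power_eq nu1 nu2 K f p)//; last by move=> k /I0[].
rewrite (Rintegral_even_power_eq nu3 nu4 K f p)//; last by move=> k /I0[].
(* The left side is now zero, whereas the right side is a product of [P(eta) ^ 2], [(2 p)!], the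
   inverse of [m 2] and a power of [tau / B], all nonzero. *)
rewrite !subrr mulr0 => /esym/eqP.
rewrite -[Complex 0 0]/(RtoC 0) rmorph0 !mulf_eq0 invr_eq0 !expf_eq0 /=.
(* Positivity comes from the lower growth bound on [m]. *)
have m2 : 0 < m 2.
  have [h _] := mbd 2; apply: lt_le_trans h.
  by rewrite mulr_gt0 ?exprn_gt0// ltr0n fact_gt0.
have BN0 : 0 < B^-1 by rewrite invr_gt0.
rewrite (negbTE P0) pnatr_eq0 (gtn_eqF (fact_gt0 _)) !fmorph_eq0 (gt_eqF m2).
by rewrite mulf_eq0 (gt_eqF tau0) (gt_eqF BN0) !andbF.
Qed.
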